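(* Let $\mathbb{F}$ be a field of characteristic zero and let $g(x) = g_0 + g_r x^r + g_{r+1}x^{r+1} + \cdots \in \mathbb{F}[[x]]$ with $g_0 = \pm 1$, $r \ge 1$ odd, and $g_r \neq 0$. Write $g(x) = g_0 + g_r\cdot \big(G(x)\big)^r$ with $G(x) = x + \cdots$, where $$G(x) = x\cdot\left(1 + \frac{g_{r+1}}{g_r}x + \frac{g_{r+2}}{g_r}x^2 + \cdots\right)^{1/r}.$$ Then there exists a unique $F(x) = f_1x + f_2x^2 + \cdots \in \mathbb{F}[[x]]$ with $f_1 \neq 0$ such that $\big(g(x), F(x)\big)$ is an involution in the Riordan group $\mathcal{R}(\mathbb{F})$. It is given by $$F(x) = \overline{G}\left(\frac{-G(x)}{\big(g_0\, g(x)\big)^{1/r}}\right).$$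
   Context: The Riordan group $\mathcal{R}(\mathbb{F})$ consists of the pairs $\big(g(x),F(x)\big)$ of formal power series over $\mathbb{F}$ with $g(x) = g_0 + g_1x + \cdots$, $g_0 \neq 0$, and $F(x) = f_1x + f_2x^2 + \cdots$, $f_1 \neq 0$ (identified with the infinite lower triangular matrix whose $(m,n)$ entry, $m,n\ge 0$, is the coefficient of $x^m$ in $g(x)F(x)^n$). Multiplication is $\big(g(x),F(x)\big)\cdot\big(h(x),K(x)\big) = \big(g(x)\cdot h(F(x)),\, K(F(x))\big)$, and the identity is $(1,x)$. An involution is an element of order exactly two; so $(g,F)\neq(1,x)$ is an involution iff $g(x)\cdot g(F(x)) = 1$ and $F(F(x)) = x$. For $a(x)\in\mathbb{F}[[x]]$ with constant term $1$ and $n$ a positive integer, $a(x)^{1/n}$ denotes the unique series with constant term $1$ whose $n$-th power is $a(x)$. For a series $G(x)$ with zero constant term and nonzero coefficient of $x$, $\overline{G}(x)$ denotes its compositional inverse. *)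

(* Defs.v *)
From HB Require Import structures.
From mathcomp Require Import all_boot all_order all_algebra.
From mathcomp Require Import boolp classical_sets.
Set Implicit Arguments.
Unset Strict Implicit.
Unset Printing Implicit Defensive.
Import GRing.Theory.
Local Open Scope ring_scope.

(* A record rather than a plain function type, so that multiplication is the
   Cauchy product and not the pointwise one. *)
Record fps (R : Type) := FPS { coefs : nat -> R }.
Coercion coefs : fps >-> Funclass.

HB.instance Definition _ (R : Type) := gen_eqMixin (fps R).
HB.instance Definition _ (R : Type) := gen_choiceMixin (fps R).

Lemma fpsP (R : Type) (a b : fps R) : (forall n, a n = b n) <-> a = b.
Proof.
split=> [|-> //]; case: a b => [a] [b] /= eq_ab.
by congr FPS; apply/funext.
Qed.

Section Zmodule.
Variable F : fieldType.
Implicit Types a b c : fps F.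

Definition fps_add a b : fps F := FPS (fun n => a n + b n).
Definition fps_opp a : fps F := FPS (fun n => - a n).

Let fps_addA : associative fps_add.
Proof. by move=> a b c; apply/fpsP => n /=; rewrite addrA. Qed.
Let fps_addC : commutative fps_add.
Proof. by move=> a b; apply/fpsP => n /=; rewrite addrC. Qed.
Let fps_add0 : left_id (FPS (fun=> 0)) fps_add.
Proof. by move=> a; apply/fpsP => n /=; rewrite add0r. Qed.
Let fps_addN : left_inverse (FPS (fun=> 0)) fps_opp fps_add.
Proof. by move=> a; apply/fpsP => n /=; rewrite addNr. Qed.

HB.instance Definition _ :=
  GRing.isZmodule.Build (fps F) fps_addA fps_addC fps_add0 fps_addN.

End Zmodule.

Section Ring.
Variable F : fieldType.
Implicit Types a b c : fps F.

Definition fpsC (c : F) : fps F := FPS (fun n => if n == 0%N then c else 0).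
Definition fpsX : fps F := FPS (fun n => (n == 1%N)%:R).
Definition fps_mul a b : fps F :=
  FPS (fun n => \sum_(i < n.+1) a i * b (n - i)%N).

Definition fps_trunc (N : nat) a : {poly F} := \poly_(i < N) a i.

Lemma fps_mul_trunc N a b n : (n < N)%N ->
  fps_mul a b n = (fps_trunc N a * fps_trunc N b)`_n.
Proof.
move=> ltnN; rewrite coefM; apply: eq_bigr => i _.
rewrite !coef_poly (leq_ltn_trans (leq_ord i) ltnN).
by rewrite (leq_ltn_trans (leq_subr i n) ltnN).
Qed.

Let fps_mulC : commutative fps_mul.
Proof.
by move=> a b; apply/fpsP => n; rewrite !(@fps_mul_trunc n.+1) // mulrC.
Qed.

Let fps_mulA : associative fps_mul.
Proof.
move=> a b c; apply/fpsP => n; pose t := fps_trunc n.+1.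
transitivity ((t a * (t b * t c))`_n).
  rewrite coefM; apply: eq_bigr => i _.
  rewrite coef_poly ltn_ord (@fps_mul_trunc n.+1 b c) //.
  by rewrite ltnS leq_subr.
rewrite mulrA coefM; apply: eq_bigr => i _.
by rewrite (@fps_mul_trunc n.+1 a b) // coef_poly ltnS leq_subr.
Qed.

Let fps_mul1 : left_id (fpsC 1) fps_mul.
Proof.
move=> a; apply/fpsP => n /=; rewrite big_ord_recl /= subn0 mul1r big1 ?addr0 //.
by move=> i _; rewrite mul0r.
Qed.

Let fps_mulDl : left_distributive fps_mul (@fps_add F).
Proof.
move=> a b c; apply/fpsP => n /=; rewrite -big_split /=.
by apply: eq_bigr => i _; rewrite mulrDl.
Qed.

Let fps_1neq0 : fpsC 1 != 0 :> fps F.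
Proof. by apply/eqP => /fpsP /(_ 0%N) /= /eqP; rewrite oner_eq0. Qed.

HB.instance Definition _ := GRing.Zmodule_isComNzRing.Build (fps F)
  fps_mulA fps_mulC fps_mul1 fps_mulDl fps_1neq0.

End Ring.

Arguments fpsX {F}.

Section UnitRing.
Variable F : fieldType.
Implicit Types a b u : fps F.

Lemma fps_coefM a b n : (a * b) n = \sum_(i < n.+1) a i * b (n - i)%N.
Proof. by []. Qed.

Lemma fps_coef0M a b : (a * b) 0%N = a 0%N * b 0%N.
Proof. by rewrite fps_coefM big_ord1. Qed.

Lemma fps_coef_sum (I : Type) (s : seq I) (E : I -> fps F) n :
  (\sum_(i <- s) E i) n = \sum_(i <- s) E i n.
Proof. by apply: (big_morph (fun a : fps F => a n)). Qed.

Lemma fps_coefX_eq0 u k n : u 0%N = 0 -> (n < k)%N -> (u ^+ k) n = 0.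
Proof.
move=> u0; elim: k n => [//|k IHk] n le_nk; rewrite exprS fps_coefM big1 //.
move=> [[|i] lti] _ /=; first by rewrite u0 mul0r.
rewrite IHk ?mulr0 // /bump /=.
case: n lti le_nk => [|n] //= _ le_nk.
by rewrite subSS (leq_ltn_trans (leq_subr i n)) // -ltnS.
Qed.

(* The geometric series 1 + u + u^2 + ... with u = 1 - a / a_0. *)
Definition fps_inv a : fps F :=
  let u := 1 - fpsC (a 0%N)^-1 * a in
  if a 0%N == 0 then a
  else fpsC (a 0%N)^-1 * FPS (fun n => (\sum_(k < n.+1) u ^+ k) n).

Definition fps_unit : pred (fps F) := fun a => a 0%N != 0.

Let fps_mulVr : {in fps_unit, left_inverse 1 fps_inv *%R}.
Proof.
move=> a a0; have {}a0 : a 0%N != 0 by [].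
rewrite /fps_inv (negbTE a0).
set c := fpsC _; set u := 1 - c * a; set s := FPS _.
have u0 : u 0%N = 0.
  have -> : u 0%N = 1 - (c * a) 0%N by [].
  by rewrite fps_coef0M mulVf ?subrr.
rewrite mulrAC; have -> : c * a = 1 - u by rewrite /u opprB addrC subrK.
apply/fpsP => n; transitivity (((1 - u) * \sum_(k < n.+1) u ^+ k) n).
  rewrite !fps_coefM; apply: eq_bigr => i _; congr (_ * _).
  rewrite /s [LHS]/= !fps_coef_sum.
  have le_n : ((n - i).+1 <= n.+1)%N by rewrite ltnS leq_subr.
  rewrite (big_ord_widen _ (fun k => (u ^+ k) (n - i)%N) le_n) big_mkcond.
  apply: eq_bigr => k _; case: ifP => // /negbT; rewrite -leqNgt => ltk.
  by rewrite fps_coefX_eq0.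
rewrite -opprB mulNr -subrX1 opprB.
have -> : (1 - u ^+ n.+1) n = (1 : fps F) n - (u ^+ n.+1) n by [].
by rewrite fps_coefX_eq0 ?subr0.
Qed.

Let fps_unitPl a b : b * a = 1 -> fps_unit a.
Proof.
move=> /fpsP /(_ 0%N); rewrite fps_coef0M => ab1; apply/eqP => a0.
by move/eqP: ab1; rewrite a0 mulr0 eq_sym oner_eq0.
Qed.

Let fps_inv_out : {in [predC fps_unit], fps_inv =1 id}.
Proof. by move=> a /negPn a0; rewrite /fps_inv a0. Qed.

HB.instance Definition _ := GRing.ComNzRing_hasMulInverse.Build (fps F)
  fps_mulVr fps_unitPl fps_inv_out.

End UnitRing.

Section Riordan.
Variable F : fieldType.
Implicit Types (a g h G H K : fps F) (p q : fps F * fps F).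

(* h(K(x)), meaningful only when K has zero constant term: then K^k has no
   coefficient below degree k, so the sum may stop at k = n. *)
Definition fps_comp h K : fps F :=
  FPS (fun n => \sum_(k < n.+1) h k * (K ^+ k) n).

(* a^(1/n); 0 if there is no such series. *)
Definition fps_root (n : nat) a : fps F :=
  xget 0 [set b : fps F | b 0%N = 1 /\ b ^+ n = a].

(* The compositional inverse; 0 if there is none. *)
Definition fps_comp_inv G : fps F :=
  xget 0 [set H : fps F |
    [/\ H 0%N = 0, fps_comp G H = fpsX & fps_comp H G = fpsX]].

Definition in_riordan p : Prop :=
  [/\ p.1 0%N != 0, p.2 0%N = 0 & p.2 1%N != 0].

Definition riordan_mul p q : fps F * fps F :=
  (p.1 * fps_comp q.1 p.2, fps_comp q.2 p.2).

Definition riordan_one : fps F * fps F := (1, fpsX).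

Definition riordan_involution p : Prop :=
  [/\ in_riordan p, p <> riordan_one & riordan_mul p p = riordan_one].

End Riordan.

(* Main.v *)
Require Import Defs.
From HB Require Import structures.
From mathcomp Require Import all_boot all_order all_algebra.
From mathcomp Require Import boolp classical_sets.
From mathcomp Require Import ring.
Set Implicit Arguments.
Unset Strict Implicit.
Unset Printing Implicit Defensive.
Import GRing.Theory.
Local Open Scope ring_scope.

(* Put a = g_0 g = 1 + c G^r, with c = g_0 g_r, and v = - G / a^(1/r).  For K
   with K(0) = 0, the equation g * g(K) = 1 reads (G o K)^r = v^r, as r is odd.
   If also K o K = x, then K = - x + ..., so that G o K and v have the same
   leading term and agree, that is, K is the composite of the inverse of G
   with v.  Conversely, this K satisfies a(K) = 1 / a, whence v o K = G and
   G o (K o K) = v o K = G, so that K o K = x. *)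

(** * Coefficients, constants, and solving equations one coefficient at a time *)

Section Coefficients.
Variable F : fieldType.
Implicit Types (a b d s u : fps F) (c : F).

Lemma fps_coefD a b n : (a + b) n = a n + b n. Proof. by []. Qed.
Lemma fps_coefB a b n : (a - b) n = a n - b n. Proof. by []. Qed.
Lemma fps_coefN a n : (- a) n = - a n. Proof. by []. Qed.

Lemma fps_coefCM c a n : (fpsC c * a) n = c * a n.
Proof.
rewrite fps_coefM big_ord_recl /= subn0 big1 ?addr0 // => i _.
by rewrite mul0r.
Qed.

Lemma fps_coef0X a n : (a ^+ n) 0%N = a 0%N ^+ n.
Proof. by elim: n => [//|n IHn]; rewrite !exprS fps_coef0M IHn. Qed.

Lemma fpsC_is_zmod_morphism : zmod_morphism (@fpsC F).
Proof.
move=> c e; apply/fpsP => n; rewrite fps_coefB /=.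
by case: eqP; rewrite ?subr0.
Qed.

Lemma fpsC_is_monoid_morphism : monoid_morphism (@fpsC F).
Proof.
split=> // c e; apply/fpsP => n; rewrite fps_coefCM /=.
by case: eqP; rewrite ?mulr0.
Qed.

HB.instance Definition _ :=
  GRing.isZmodMorphism.Build F (fps F) (@fpsC F) fpsC_is_zmod_morphism.
HB.instance Definition _ :=
  GRing.isMonoidMorphism.Build F (fps F) (@fpsC F) fpsC_is_monoid_morphism.

Lemma fps_coefXM a n : (fpsX * a) n = if n is m.+1 then a m else 0.
Proof.
rewrite fps_coefM; case: n => [|n]; first by rewrite big_ord1 mul0r.
rewrite !big_ord_recl /= mul0r add0r mul1r subSS subn0 big1 ?addr0 // => i _.
by rewrite mul0r.
Qed.

Lemma fps_coefXnM k a n :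
  (fpsX ^+ k * a) n = if (n < k)%N then 0 else a (n - k)%N.
Proof.
elim: k n => [|k IHk] n; first by rewrite mul1r subn0.
by rewrite exprS -mulrA fps_coefXM; case: n => // n; rewrite IHk.
Qed.

Lemma fps_mulXnI k : injective (fun a : fps F => fpsX ^+ k * a).
Proof.
move=> a b /fpsP eq_ab; apply/fpsP => n; move: (eq_ab (n + k)%N).
by rewrite !fps_coefXnM ltnNge leq_addl addnK.
Qed.

Lemma fps_divX u : u 0%N = 0 -> exists2 s, u = fpsX * s & s 0%N = u 1%N.
Proof.
move=> u0; exists (FPS (fun n => u n.+1)) => //; apply/fpsP => n.
by rewrite fps_coefXM; case: n.
Qed.

Lemma fps_unitrE a : (a \is a GRing.unit) = (a 0%N != 0). Proof. by []. Qed.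

Lemma fps_coefM_low d s m : (forall i, (i < m)%N -> d i = 0) ->
  (d * s) m = d m * s 0%N.
Proof.
move=> d0; rewrite fps_coefM big_ord_recr /= subnn big1 ?add0r // => i _.
by rewrite d0 ?mul0r.
Qed.

(** The sum is the cofactor of [a - b] in [a ^+ n - b ^+ n]. Its constant term serves as the slope
    in Newton iteration and, when nonzero, makes the cofactor a unit. *)
Lemma fps_coef0_subrX a b n : a 0%N = b 0%N ->
  (\sum_(i < n) a ^+ (n.-1 - i) * b ^+ i) 0%N = a 0%N ^+ n.-1 *+ n.
Proof.
move=> ab0; rewrite fps_coef_sum (eq_bigr (fun=> a 0%N ^+ n.-1)).
  by rewrite sumr_const card_ord.
move=> i _; rewrite fps_coef0M !fps_coef0X -ab0 -exprD subnK //.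
by rewrite -ltnS (leq_trans (ltn_ord i)) ?leqSpred.
Qed.

(** As [a - b] vanishes below degree [m], only the constant term of its cofactor in
    [a ^+ n - b ^+ n] reaches degree [m]. *)
Lemma fps_coef_subrX a b n m : a 0%N = b 0%N ->
  (forall i, (i < m)%N -> a i = b i) ->
  (a ^+ n) m - (b ^+ n) m = (a 0%N ^+ n.-1 *+ n) * (a m - b m).
Proof.
move=> ab0 eq_ab; rewrite -fps_coefB subrXX fps_coefM_low => [|i /eq_ab abi].
  by rewrite fps_coef0_subrX // mulrC.
by rewrite fps_coefB abi subrr.
Qed.

(* Newton iteration: [E] is affine in the last coefficient, with slope [l]. *)
Lemma fps_solve (E : fps F -> fps F) (a : fps F) (c l : F) :
    l != 0 -> E (fpsC c) 0%N = a 0%N ->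
    (forall (b d : fps F) m, b 0%N = c -> d 0%N = c ->
       (forall i, (i < m)%N -> b i = d i) ->
       E b m - E d m = l * (b m - d m)) ->
  exists2 b : fps F, b 0%N = c & E b = a.
Proof.
move=> l0 Ea0 Elin.
(* The fixed points of [Phi] are the solutions of [E b = a]. [Phi] is an x-adic contraction:
   agreement below degree [m] becomes agreement through degree [m]. *)
pose Phi b := b - fpsC l^-1 * (E b - a).
have PhiE b n : Phi b n = b n - l^-1 * (E b n - a n).
  by rewrite fps_coefB fps_coefCM.
have Phi0 b : b 0%N = c -> Phi b 0%N = c.
  move=> b0; rewrite PhiE -Ea0 (Elin _ (fpsC c)) // b0.
  by rewrite subrr !mulr0 subr0.
have Phi_contr b d m : b 0%N = c -> d 0%N = c ->
    (forall i, (i < m)%N -> b i = d i) ->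
    forall i, (i < m.+1)%N -> Phi b i = Phi d i.
  move=> b0 d0 eq_bd i; rewrite ltnS => le_im.
  have eq_i j : (j < i)%N -> b j = d j.
    by move=> lt_ji; apply: eq_bd; apply: leq_trans lt_ji le_im.
  apply/eqP; rewrite -subr_eq0.
  have -> : Phi b i - Phi d i = b i - d i - l^-1 * (E b i - E d i).
    by rewrite !PhiE; ring.
  by rewrite Elin // mulKf // subrr.
pose x k := iter k Phi (fpsC c).
have x0 k : x k 0%N = c by elim: k => //= k IHk; apply: Phi0.
have x_step k i : (i < k)%N -> x k i = x k.+1 i.
  by elim: k i => // k IHk; apply: Phi_contr (x0 k) (x0 k.+1) IHk.
have x_stable j k i : (i < k)%N -> x k i = x (j + k)%N i.
  move=> lt_ik; elim: j => // j ->.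
  by rewrite addSn -x_step // (leq_trans lt_ik) ?leq_addl.
(* The x-adic limit of the iterates: coefficient [n] is final from [x n.+1] on. *)
pose b := FPS (fun n => x n.+1 n).
have b0 : b 0%N = c by apply: (x0 1%N).
have b_x m i : (i < m)%N -> b i = x m i.
  move=> lt_im; rewrite -(subnK lt_im).
  exact: (x_stable (m - i.+1)%N i.+1 i (ltnSn i)).
exists b => //; apply/fpsP => n.
have : Phi b n = b n by apply: (Phi_contr b (x n) n) => //; apply: b_x.
rewrite PhiE => /eqP; rewrite -subr_eq0 addrC addKr oppr_eq0 mulf_eq0.
by rewrite invr_eq0 (negbTE l0) subr_eq0 => /eqP.
Qed.

End Coefficients.

(** * Composition of series and compositional inverses *)

Section Composition.
Variable F : fieldType.
Implicit Types (a b f h G H K : fps F) (c : F) (p : {poly F}).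

Lemma fps_comp_eq n h h' K : (forall k, (k <= n)%N -> h k = h' k) ->
  fps_comp h K n = fps_comp h' K n.
Proof.
by move=> eq_h; apply: eq_bigr => k _; rewrite eq_h // -ltnS.
Qed.

Lemma fps_coef0_comp h K : fps_comp h K 0%N = h 0%N.
Proof. by rewrite /= big_ord1 mulr1. Qed.

Lemma fps_coef1_comp h K : fps_comp h K 1%N = h 1%N * K 1%N.
Proof. by rewrite /= !big_ord_recl big_ord0 /= mulr0 add0r addr0. Qed.

Lemma fps_compX K : K 0%N = 0 -> fps_comp fpsX K = K.
Proof.
move=> K0; apply/fpsP => -[|n]; first by rewrite fps_coef0_comp.
rewrite /= !big_ord_recl /= mul0r add0r mul1r big1 ?addr0 // => i _.
by rewrite mul0r.
Qed.

Lemma fps_compr_X h : fps_comp h fpsX = h.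
Proof.
apply/fpsP => n; have Xn k : (fpsX ^+ k : fps F) n = (n == k)%:R.
  rewrite -[_ ^+ k]mulr1 fps_coefXnM; case: ltngtP => // [lt_kn|->].
    by rewrite /= subn_eq0 leqNgt lt_kn.
  by rewrite subnn.
rewrite /= big_ord_recr /= Xn eqxx mulr1 big1 ?add0r // => i _.
by rewrite Xn gtn_eqF ?mulr0.
Qed.

Section RightArgument.
Variable K : fps F.
Hypothesis K0 : K 0%N = 0.

(** This bridge to polynomial evaluation lets composition inherit the laws of [horner]. The two sums
    differ only in powers of [K] above [n], which have no coefficient in degree [n]. *)
Lemma fps_coef_horner p n :
  (map_poly (@fpsC F) p).[K] n = fps_comp (FPS (fun k => p`_k)) K n.
Proof.
have sz : (size (map_poly (@fpsC F) p) <= maxn (size p) n.+1)%N.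
  by rewrite (leq_trans (size_poly _ _)) ?leq_maxl.
rewrite (horner_coef_wide _ sz) fps_coef_sum.
have le_n := leq_maxr (size p) n.+1.
rewrite [RHS](big_ord_widen _ (fun k => p`_k * (K ^+ k) n) le_n).
rewrite [RHS]big_mkcond; apply: eq_bigr => k _.
rewrite coef_map fps_coefCM; case: ifP => // /negbT; rewrite -leqNgt => lt_nk.
by rewrite fps_coefX_eq0 ?mulr0.
Qed.

Lemma fps_comp_trunc N h n : (n < N)%N ->
  fps_comp h K n = (map_poly (@fpsC F) (fps_trunc N h)).[K] n.
Proof.
move=> lt_nN; rewrite fps_coef_horner; apply: fps_comp_eq => k le_kn /=.
by rewrite coef_poly (leq_ltn_trans le_kn).
Qed.

Lemma fps_compD a b : fps_comp (a + b) K = fps_comp a K + fps_comp b K.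
Proof.
apply/fpsP => n; rewrite fps_coefD /= -big_split /=.
by apply: eq_bigr => k _; rewrite -mulrDl.
Qed.

Lemma fps_compN a : fps_comp (- a) K = - fps_comp a K.
Proof.
apply/fpsP => n; rewrite fps_coefN /= -sumrN.
by apply: eq_bigr => k _; rewrite -mulNr.
Qed.

Lemma fps_compC c : fps_comp (fpsC c) K = fpsC c.
Proof.
apply/fpsP => n; rewrite /= big_ord_recl big1 => [|i _]; last by rewrite mul0r.
by rewrite addr0; case: n => [|n] /=; rewrite ?mulr1 ?mulr0.
Qed.

(** Coefficient [n] depends only on the truncations at [n.+1], and for these polynomials evaluation
    at [K] is multiplicative. *)
Lemma fps_compM a b : fps_comp (a * b) K = fps_comp a K * fps_comp b K.
Proof.
apply/fpsP => n; pose t := @fps_trunc F n.+1.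
transitivity ((map_poly (@fpsC F) (t a * t b)).[K] n).
  rewrite fps_coef_horner; apply: fps_comp_eq => k le_kn /=.
  by rewrite -fps_mul_trunc.
rewrite rmorphM hornerM !fps_coefM; apply: eq_bigr => i _.
by rewrite -!fps_comp_trunc // ltnS leq_subr.
Qed.

Lemma fps_comp1 : fps_comp 1 K = 1. Proof. exact: fps_compC. Qed.

Lemma fps_compXn a n : fps_comp (a ^+ n) K = fps_comp a K ^+ n.
Proof. by elim: n => [|n IHn]; rewrite ?fps_comp1 // !exprS fps_compM IHn. Qed.

Lemma fps_compV a : a 0%N != 0 -> fps_comp a^-1 K = (fps_comp a K)^-1.
Proof.
move=> a0; have Ua : a \is a GRing.unit by [].
have UaK : fps_comp a K \is a GRing.unit by rewrite fps_unitrE fps_coef0_comp.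
by apply: (mulrI UaK); rewrite divrr // -fps_compM divrr // fps_comp1.
Qed.

End RightArgument.

(** For a fixed coefficient, [f] may be truncated to a polynomial. Induction along Horner's scheme
    then applies, since composing with [K] on the right respects sums, products and constants. *)
Lemma fps_compA f G K : G 0%N = 0 -> K 0%N = 0 ->
  fps_comp (fps_comp f G) K = fps_comp f (fps_comp G K).
Proof.
move=> G0 K0; have GK0 : fps_comp G K 0%N = 0 by rewrite fps_coef0_comp.
apply/fpsP => n; rewrite [RHS](@fps_comp_trunc _ GK0 n.+1) //.
transitivity (fps_comp (map_poly (@fpsC F) (fps_trunc n.+1 f)).[G] K n).
  by apply: fps_comp_eq => k le_kn; rewrite -(@fps_comp_trunc _ G0 n.+1).
congr (coefs _ n); elim/poly_ind: (fps_trunc _ _) => [|p c IHp].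
  by rewrite rmorph0 !horner0 -(rmorph0 (@fpsC F)) fps_compC.
by rewrite rmorphD rmorphM /= map_polyX map_polyC !hornerE /=
  fps_compD fps_compM // fps_compC IHp.
Qed.

Lemma fps_right_inverse G : G 0%N = 0 -> G 1%N != 0 ->
  exists2 H : fps F, H 0%N = 0 & fps_comp G H = fpsX.
Proof.
move=> G0 G1; apply: (@fps_solve F _ _ 0 (G 1%N)) => //.
  by rewrite fps_coef0_comp.
move=> H K m H0 K0 eq_HK; rewrite -sumrB.
(* Only the linear term of [G] sees a change in coefficient [m]: for [k > 1] the slope of the [k]-th
   power has a factor [H 0 = 0]. For [m = 0] there is no linear term, but both sides vanish. *)
rewrite (eq_bigr (fun k : 'I_m.+1 =>
    if k == 1%N :> nat then G 1%N * (H m - K m) else 0)).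
  case: m eq_HK => [|m] eq_HK; first by rewrite big_ord1 H0 K0 subrr mulr0.
  by rewrite !big_ord_recl big1 => [|//] /=; rewrite add0r addr0.
move=> k _; rewrite -mulrBr fps_coef_subrX ?H0 ?K0 //.
case: (k : nat) => [|[|j]] /=; rewrite ?mulr0n ?mul0r ?mulr0 ?mulr1n ?mul1r //.
by rewrite expr0n /= mul0rn mul0r mulr0.
Qed.

(** A right inverse [H] of [G] has itself a right inverse [K], and associativity forces [G = K]. *)
Lemma fps_inverse_ex G : G 0%N = 0 -> G 1%N != 0 -> exists H : fps F,
  [/\ H 0%N = 0, fps_comp G H = fpsX & fps_comp H G = fpsX].
Proof.
move=> G0 G1; have [H H0 GH] := fps_right_inverse G0 G1.
have H1 : H 1%N != 0.
  apply/eqP => H1; have /fpsP/(_ 1%N)/eqP := GH.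
  by rewrite fps_coef1_comp H1 mulr0 eq_sym oner_eq0.
have [K K0 HK] := fps_right_inverse H0 H1.
have GK : G = K by rewrite -(fps_compr_X G) -HK -fps_compA // GH fps_compX.
by exists H; split=> //; rewrite {1}GK.
Qed.

Lemma fps_comp_invP G : G 0%N = 0 -> G 1%N != 0 ->
  [/\ fps_comp_inv G 0%N = 0, fps_comp G (fps_comp_inv G) = fpsX
    & fps_comp (fps_comp_inv G) G = fpsX].
Proof. by move=> G0 G1; apply: (xgetPex 0 (fps_inverse_ex G0 G1)). Qed.

End Composition.

(** * Roots in characteristic zero *)

Section Roots.
Variable F : fieldType.
Hypothesis charF0 : [pchar F] =i pred0.
Implicit Types (a b u v : fps F) (n : nat).

(** The cofactor of [a - b] in [a ^+ n - b ^+ n] is a unit, its constant term being [n] times a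
    power of [a 0]. *)
Lemma fps_expI n a b : (0 < n)%N -> a 0%N = b 0%N -> a 0%N != 0 ->
  a ^+ n = b ^+ n -> a = b.
Proof.
move=> n0 ab0 a0 /eqP; rewrite -subr_eq0 subrXX => /eqP abn.
apply/eqP; rewrite -subr_eq0; apply/eqP.
have /mulIr : \sum_(i < n) a ^+ (n.-1 - i) * b ^+ i \is a GRing.unit.
  rewrite fps_unitrE fps_coef0_subrX // -mulr_natr mulf_neq0 ?expf_neq0 //.
  by rewrite ((pcharf0P F).1 charF0) -lt0n.
by apply; rewrite abn mul0r.
Qed.

Lemma fps_expI_lead n u v : (0 < n)%N -> u 0%N = 0 -> v 0%N = 0 ->
  u 1%N = v 1%N -> v 1%N != 0 -> u ^+ n = v ^+ n -> u = v.
Proof.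
move=> n0 /fps_divX[s -> s0] /fps_divX[t -> t0]; rewrite -s0 -t0 => st0 tn0.
rewrite !exprMn => /fps_mulXnI eq_st; congr (_ * _).
by apply: (@fps_expI n) => //; rewrite st0.
Qed.

Lemma fps_rootP n a : (0 < n)%N -> a 0%N = 1 ->
  fps_root n a 0%N = 1 /\ fps_root n a ^+ n = a.
Proof.
move=> n0 a0; apply: (@xgetPex _ 0 [set b : fps F | b 0%N = 1 /\ b ^+ n = a]).
(* At constant term 1 the slope of the [n]-th power is [n], nonzero in characteristic zero. *)
have [||b d m b0 d0 eq_bd|b b0 bn] :=
    @fps_solve F (fun b => b ^+ n) a 1 n%:R.
- by rewrite ((pcharf0P F).1 charF0) -lt0n.
- by rewrite fps_coef0X expr1n a0.
- by rewrite fps_coef_subrX ?b0 ?d0 // expr1n.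
by exists b.
Qed.

End Roots.

(** * Existence and uniqueness of the second component *)

Theorem theorem3p3 (F : fieldType) (charF0 : [pchar F] =i pred0)
    (g : fps F) (r : nat)
    (g0 : g 0%N = 1 \/ g 0%N = -1)
    (r_odd : odd r)
    (g_gap : forall i : nat, (0 < i < r)%N -> g i = 0)
    (gr_neq0 : g r != 0) :
  let G : fps F := fpsX * fps_root r (FPS (fun i => g (r + i)%N / g r)) in
  let F0 : fps F :=
    fps_comp (fps_comp_inv G) (- G / fps_root r (fpsC (g 0%N) * g)) in
  [/\ G 0%N = 0 /\ G 1%N = 1,
      g = fpsC (g 0%N) + fpsC (g r) * G ^+ r,
      exists! K : fps F, riordan_involution (g, K)
    & riordan_involution (g, F0)].
Proof.
have r_gt0 : (0 < r)%N by case: (r) r_odd.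
set s := FPS _ => G.
(* From here on [K] stands for the [F0] of the statement. *)
set e := g 0%N; set b := fps_root r (fpsC e * g); set v := - G / b => K.
have e_neq0 : e != 0 by rewrite /e; case: g0 => ->; rewrite ?oppr_eq0 oner_eq0.
have ee : e * e = 1 by rewrite /e; case: g0 => ->; rewrite ?mulrNN mulr1.
have eeC : fpsC e * fpsC e = 1 by rewrite -rmorphM ee.
have [s0 sr] : fps_root r s 0%N = 1 /\ fps_root r s ^+ r = s.
  by apply: fps_rootP => //=; rewrite addn0 divff.
have G0 : G 0%N = 0 by rewrite fps_coefXM.
have G1 : G 1%N = 1 by rewrite fps_coefXM.
have G1n0 : G 1%N != 0 by rewrite G1 oner_eq0.
have gE : g = fpsC e + fpsC (g r) * G ^+ r.
  apply/fpsP => n; rewrite fps_coefD fps_coefCM exprMn sr fps_coefXnM /=.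
  case: ltnP => [lt_nr|le_rn]; last first.
    rewrite gtn_eqF ?add0r; last exact: leq_trans le_rn.
    by rewrite subnKC // mulrC divfK.
  rewrite mulr0 addr0; case: eqP => [->//|/eqP]; rewrite -lt0n => n_gt0.
  by rewrite g_gap // n_gt0.
have [b0 br] : b 0%N = 1 /\ b ^+ r = fpsC e * g.
  by apply: fps_rootP; rewrite // fps_coefCM.
have b0n0 : b 0%N != 0 by rewrite b0 oner_eq0.
have Ub : b \is a GRing.unit by [].
have v0 : v 0%N = 0 by rewrite fps_coef0M fps_coefN G0 oppr0 mul0r.
have bV0 : b^-1 0%N = 1.
  by have /fpsP/(_ 0%N) := divrr Ub; rewrite fps_coef0M b0 mul1r.
have v1 : v 1%N = -1.
  rewrite fps_coefM_low => [|[]//]; first by rewrite fps_coefN G1 bV0 mulr1.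
  by rewrite fps_coefN G0 oppr0.
have vr : v ^+ r * (fpsC e * g) = - G ^+ r.
  by rewrite -br -exprMn divrK // exprNn -signr_odd r_odd expr1 mulN1r.
have Ug : fpsC e * g \is a GRing.unit by rewrite -br unitrX.
have g_compE (k : fps F) : k 0%N = 0 ->
    fpsC e * fps_comp g k = 1 + fpsC (e * g r) * fps_comp G k ^+ r.
  move=> k0; rewrite [X in fps_comp X _]gE fps_compD fps_compM //.
  by rewrite !fps_compC fps_compXn // mulrDr eeC mulrA -rmorphM.
have egE : fpsC e * g = 1 + fpsC (e * g r) * G ^+ r.
  by rewrite [X in _ * X]gE mulrDr eeC mulrA -rmorphM.
have gg_iff (k : fps F) : k 0%N = 0 ->
    g * fps_comp g k = 1 <-> fps_comp G k ^+ r = v ^+ r.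
  (* As [e * e = 1], the left side is [e g] times [e g(k)]. Expanding the second factor, then the
     lone [e g], isolates 1; by [vr] the bracket is [e g] times the difference of the two [r]-th
     powers. *)
  move=> k0; have -> : g * fps_comp g k =
      1 + fpsC (e * g r) * (G ^+ r + fps_comp G k ^+ r * (fpsC e * g)).
    rewrite -[LHS]mul1r -{1}eeC mulrACA g_compE // mulrDr mulr1 {1}egE.
    by rewrite mulrDr addrA mulrCA [_ ^+ r * (_ * _)]mulrC.
  split=> [/eqP|->]; last by rewrite vr subrr mulr0 addr0.
  have Uc : fpsC (e * g r) \is a GRing.unit by rewrite fps_unitrE mulf_neq0.
  rewrite -[X in _ == X]addr0 (inj_eq (addrI _)) => /eqP eq0.
  have /eqP := mulrI Uc (etrans eq0 (esym (mulr0 _))).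
  rewrite addrC addr_eq0 -vr => /eqP eq_M.
  exact: (mulIr Ug).
have [Gi0 GGi GiG] := fps_comp_invP G0 G1n0.
have K0 : K 0%N = 0 by rewrite fps_coef0_comp.
have GK : fps_comp G K = v by rewrite -fps_compA // GGi fps_compX.
have K1 : K 1%N = -1 by move: (fps_coef1_comp G K); rewrite GK v1 G1 mul1r.
have gK : g * fps_comp g K = 1 by apply/gg_iff; rewrite ?GK.
(* Both sides have constant term 1, and their [r]-th powers agree by [gK]. *)
have bK : fps_comp b K = b^-1.
  apply: (@fps_expI _ charF0 r) => //; rewrite ?fps_coef0_comp ?bV0 //.
  rewrite -fps_compXn // exprVn br fps_compM // fps_compC.
  apply: (mulrI Ug); rewrite divrr // mulrACA eeC mul1r.
  exact: gK.
have vK : fps_comp v K = G.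
  rewrite fps_compM // fps_compN fps_compV // bK invrK GK.
  by rewrite mulNr divrK // opprK.
have KK : fps_comp K K = fpsX by rewrite {1}/K fps_compA // vK.
have invK : riordan_involution (g, K).
  split; last by rewrite /riordan_mul /= gK KK.
    by split; rewrite // [_ 1%N]K1 oppr_eq0 oner_eq0.
  (* The coefficient of degree [r > 0] tells [g] from 1. *)
  case=> /fpsP/(_ r) /eqP; rewrite -[_ == _]/(g r == if r == 0%N then 1 else 0).
  by rewrite gtn_eqF // (negbTE gr_neq0).
split=> //; exists K; split=> // k [[_ /= k0 _] _ invol].
have gk : g * fps_comp g k = 1 := congr1 fst invol.
have kk : fps_comp k k = fpsX := congr1 snd invol.
have Gkr : fps_comp G k ^+ r = v ^+ r := (gg_iff k k0).1 gk.
have k11 : k 1%N * k 1%N = 1 by rewrite -fps_coef1_comp kk.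
have Gk0 : fps_comp G k 0%N = 0 by rewrite fps_coef0_comp.
have Gk1 : fps_comp G k 1%N = k 1%N by rewrite fps_coef1_comp G1 mul1r.
(* Comparing lowest coefficients in [Gkr] gives [k 1 ^+ r = -1]; as [r] is odd and [k 1] squares to
   1, this power is [k 1] itself. *)
have k1 : k 1%N = -1.
  have [p pE p0] := fps_divX Gk0; have [q qE q0] := fps_divX v0.
  move: Gkr; rewrite pE qE !exprMn => /fps_mulXnI/fpsP/(_ 0%N).
  rewrite !fps_coef0X p0 q0 Gk1 v1 -signr_odd r_odd expr1.
  rewrite -(odd_double_half r) r_odd exprS -mul2n exprM expr2 k11.
  by rewrite expr1n mulr1.
have Gk : fps_comp G k = v.
  apply: (@fps_expI_lead _ charF0 r) => //; rewrite ?Gk1 v1 //.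
  by rewrite oppr_eq0 oner_eq0.
by rewrite /K -Gk -fps_compA // GiG fps_compX.
Qed.
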